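(* For every ST-program P over V-structures, there is an existential formula φ_P[f_1,…,f_n, g_1,…,g_n] (with f_1,…,f_n and g_1,…,g_n vectors of function variables whose arities match the identifiers of V) that holds iff the structure given by (f_1,…,f_n) yields the structure given by (g_1,…,g_n) under P, i.e. iff (f_1,…,f_n) is transformed by P into (g_1,…,g_n).
   Context: Setting: A is a denumerable set of unstructured atoms, extended with a fresh element ⊥ (''undefined''). A k-ary A-function is a finite partial function from A^k to A, identified with its strict total extension to A_⊥ (output ⊥ whenever the function is undefined or some input is ⊥). A vocabulary V is a finite set of function identifiers f_1,…,f_n with arities; an A-structure over V assigns to each identifier of arity k a k-ary A-function. Terms are built from the constant ω (always denoting ⊥) and function identifiers/variables by application. Formulas are second-order: built from equations t ≐ q between terms by propositional connectives and quantifiers ∀f, ∃f over variables f of any arity k ≥ 0, where quantifiers range over all finite A-functions of that arity (nullary variables range over A_⊥). A formula is existential if it has the form of existential quantifiers (atomic or functional) applied to a first-order formula (one whose quantifiers are only over atomic variables); conjunctions/disjunctions of existential formulas with first-order formulas are also existential in this sense. ST-programs over V: the basic operations (revisions) are: extension f t_1…t_k := q (if f t_1…t_k is undefined, set it to the value of q); inception c⇓ for a token c (if c is undefined, set it to a fresh atom not in the scope of the structure); contraction f t_1…t_k↑ (make f t_1…t_k undefined); deletion c⇑ (remove the atom denoted by c, i.e. make every entry whose value is that atom undefined). Programs are generated from revisions by composition P;Q, branching if[G]{P}{Q}, and iteration do[G]{P}, where a guard G is a quantifier-free formula. The binary yield relation ⇒_P between structures is defined by recursion on P in the usual way (for revisions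 following the intended semantics above; for do[G]{P}, repeat P while G holds, ending in a structure falsifying G). *)

(* Defs.v *)
From HB Require Import structures.
From mathcomp Require Import all_boot finmap.

Set Implicit Arguments.
Unset Strict Implicit.
Unset Printing Implicit Defensive.

Local Open Scope fmap_scope.

(* The value "undefined" is [None]: the atoms extended with it form [option A]. *)

Definition afun (A : choiceType) (k : nat) := {fmap k.-tuple A -> A}.

(* The tuple of the given values, if they are all defined: [pmap] drops the
   undefined ones, and [insub] fails if fewer than [k] remain. *)
Definition all_defined (A : choiceType) (k : nat) (xs : 'I_k -> option A) :
  option (k.-tuple A) := insub (pmap xs (enum 'I_k)).

Lemma all_definedP (A : choiceType) (k : nat) (xs : 'I_k -> option A)
  (ys : k.-tuple A) :
  all_defined xs = Some ys <-> forall i, xs i = Some (tnth ys i).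
Proof.
have Eys : tval ys = [seq tnth ys i | i <- enum 'I_k].
  by rewrite map_tnth_enum.
split=> [Exs i | Exs]; last first.
  suff Ep : pmap xs (enum 'I_k) = tval ys by rewrite /all_defined Ep valK.
  rewrite (eq_pmap Exs) Eys.
  by elim: (enum _) => //= j s <-.
have Ep : pmap xs (enum 'I_k) = tval ys.
  by move: Exs; rewrite /all_defined; case: insubP => // u _ <- [->].
have all_xs : all (fun i => xs i : bool) (enum 'I_k).
  rewrite all_count -size_pmap Ep size_tuple; exact/eqP/esym/size_enum_ord.
have Em : map xs (enum 'I_k) = map some ys.
  rewrite -Ep; elim: (enum _) all_xs => //= j s IHs /andP[].
  by case: (xs j) => //= a _ /IHs ->.
have i_lt : i < size (enum 'I_k) by rewrite size_enum_ord.
have := congr1 (fun s => nth None s i) Em.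
rewrite (nth_map i) // nth_ord_enum (nth_map (tnth ys i)) ?size_tuple //.
by rewrite -tnth_nth.
Qed.

(* The strict total extension of a finite partial function. *)
Definition app (A : choiceType) (k : nat) (f : afun A k)
  (xs : 'I_k -> option A) : option A :=
  obind (fun ys => f.[? ys]) (all_defined xs).

Record vocabulary := Vocabulary { ident :> finType; arity : ident -> nat }.

Definition structure (A : choiceType) (V : vocabulary) :=
  forall f : V, afun A (arity f).

Inductive term (V : vocabulary) : Type :=
| Omega
| App (f : V) (ts : 'I_(arity f) -> term V).

Fixpoint eval (A : choiceType) (V : vocabulary) (S : structure A V)
  (t : term V) : option A :=
  match t with
  | Omega => None
  | App f ts => app (S f) (fun i => eval S (ts i))
  end.

(* Formulas are well scoped: [form V] consists of the formulas whose free
   function symbols (identifiers or variables) are those of [V], and binding a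
   variable of arity [k] moves from [V] to [vext V k], in which [None] is the
   bound variable. *)
Definition vext (V : vocabulary) (k : nat) : vocabulary :=
  @Vocabulary (option V) (fun x => if x is Some f then arity f else k).

Definition sext (A : choiceType) (V : vocabulary) (k : nat)
  (S : structure A V) (h : afun A k) : structure A (vext V k) :=
  fun x => match x return afun A (@arity (vext V k) x) with
           | Some f => S f
           | None => h
           end.

Inductive form (V : vocabulary) : Type :=
| Eqn (t q : term V)
| Neg (p : form V)
| And (p q : form V)
| Or (p q : form V)
| Imp (p q : form V)
| All (k : nat) (p : form (vext V k))
| Ex (k : nat) (p : form (vext V k)).

Fixpoint sat (A : choiceType) (V : vocabulary) (S : structure A V)
  (p : form V) {struct p} : Prop :=
  match p with
  | Eqn t q => eval S t = eval S q
  | Neg p => ~ sat S p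
  | And p q => sat S p /\ sat S q
  | Or p q => sat S p \/ sat S q
  | Imp p q => sat S p -> sat S q
  | All k p => forall h : afun A k, sat (sext S h) p
  | Ex k p => exists h : afun A k, sat (sext S h) p
  end.

Fixpoint quantifier_free (V : vocabulary) (p : form V) : bool :=
  match p with
  | Eqn _ _ => true
  | Neg p => quantifier_free p
  | And p q | Or p q | Imp p q => quantifier_free p && quantifier_free q
  | All _ _ | Ex _ _ => false
  end.

Fixpoint first_order (V : vocabulary) (p : form V) : bool :=
  match p with
  | Eqn _ _ => true
  | Neg p => first_order p
  | And p q | Or p q | Imp p q => first_order p && first_order q
  | All k p | Ex k p => (k == 0) && first_order p
  end.

Inductive existential : forall V : vocabulary, form V -> Prop :=
| Ex_fo V (p : form V) : first_order p -> existential p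
| Ex_ex V k (p : form (vext V k)) : existential p -> existential (Ex p)
| Ex_andl V (p q : form V) :
    existential p -> first_order q -> existential (And p q)
| Ex_andr V (p q : form V) :
    first_order p -> existential q -> existential (And p q)
| Ex_orl V (p q : form V) :
    existential p -> first_order q -> existential (Or p q)
| Ex_orr V (p q : form V) :
    first_order p -> existential q -> existential (Or p q).

Definition token (V : vocabulary) := {c : V | arity c == 0}.

(* There are no arguments, so the function given here has empty domain. *)
Definition tok (V : vocabulary) (c : token V) : term V :=
  App (fun _ : 'I_(arity (val c)) => Omega V).

Definition guard (V : vocabulary) := {G : form V | quantifier_free G}.

Inductive revision (V : vocabulary) : Type :=
| Extension (f : V) (ts : 'I_(arity f) -> term V) (q : term V)
| Inception (c : token V)
| Contraction (f : V) (ts : 'I_(arity f) -> term V)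
| Deletion (c : token V).

Inductive program (V : vocabulary) : Type :=
| Revise (r : revision V)
| Comp (P Q : program V)
| Branch (G : guard V) (P Q : program V)
| Iter (G : guard V) (P : program V).

Definition in_scope (A : choiceType) (V : vocabulary) (S : structure A V)
  (a : A) : Prop :=
  exists (f : V) (xs : (arity f).-tuple A) (b : A),
    (S f).[? xs] = Some b /\ (a \in xs \/ a = b).

(* [S] with the value of [f] at [xs] replaced by [v], possibly undefined. By
   strictness nothing can change if some component of [xs] is undefined. *)
Definition set_at (A : choiceType) (V : vocabulary) (S : structure A V)
  (f : V) (xs : 'I_(arity f) -> option A) (v : option A) : structure A V :=
  if all_defined xs is Some ys then
    dfwith S (if v is Some a then (S f).[ys <- a] else (S f).[~ ys])
  else S.

(* In the case of a deletion, if [c] is undefined then no entry is removed. *)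
Definition revises (A : choiceType) (V : vocabulary) (r : revision V)
  (S S' : structure A V) : Prop :=
  match r with
  | Extension f ts q =>
      S' = if eval S (App ts) is None
           then set_at S (fun i => eval S (ts i)) (eval S q) else S
  | Inception c =>
      if eval S (tok c) is None then
        exists2 a : A, ~ in_scope S a &
          S' = set_at S (fun _ : 'I_(arity (val c)) => None) (Some a)
      else S' = S
  | Contraction f ts => S' = set_at S (fun i => eval S (ts i)) None
  | Deletion c =>
      forall (f : V) (xs : (arity f).-tuple A),
        (S' f).[? xs] = if (S f).[? xs] == eval S (tok c) then None
                        else (S f).[? xs]
  end.

Inductive iterates (A : choiceType) (V : vocabulary) (G : form V)
  (step : structure A V -> structure A V -> Prop) :
  structure A V -> structure A V -> Prop :=
| Iterates_stop S : ~ sat S G -> iterates G step S S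
| Iterates_step S S1 S' :
    sat S G -> step S S1 -> iterates G step S1 S' -> iterates G step S S'.

Fixpoint yields (A : choiceType) (V : vocabulary) (P : program V)
  (S S' : structure A V) : Prop :=
  match P with
  | Revise r => revises r S S'
  | Comp P Q => exists2 S1, yields P S S1 & yields Q S1 S'
  | Branch G P Q =>
      (sat S (val G) /\ yields P S S') \/ (~ sat S (val G) /\ yields Q S S')
  | Iter G P => iterates (val G) (yields P) S S'
  end.

(* Two variables for each identifier: [inl f] for its value before and [inr f]
   for its value after the execution of a program. *)
Definition vpair (V : vocabulary) : vocabulary :=
  @Vocabulary (V + V)%type
    (fun x => match x with inl f => arity f | inr f => arity f end).

Definition spair (A : choiceType) (V : vocabulary) (S S' : structure A V) :
  structure A (vpair V) :=
  fun x => match x return afun A (@arity (vpair V) x) with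
           | inl f => S f
           | inr f => S' f
           end.

(* Main.v *)
(** The states of a run of [do[G]{P}] are coded by functions with one more
    argument, the time, which ranges over atoms, and the witnesses of the
    formula for [P] are treated in the same way. Time is ordered by a unary
    function variable: it is required to be injective, to omit the initial
    moment from its range, and to be undefined at no moment but the last. Since
    function variables range over finite functions, the moments reachable from
    the initial one form a finite sequence, so no first-order description of
    finiteness is needed. Conversely a run of any length can be coded because
    there are infinitely many atoms. *)

Require Import Defs.
From HB Require Import structures.
From mathcomp Require Import all_boot finmap.
From Stdlib Require Import Classical FunctionalExtensionality.

Set Implicit Arguments.
Unset Strict Implicit.
Unset Printing Implicit Defensive.

Local Open Scope fmap_scope.

(** * Definability *)

Section Definability.

Variable A : choiceType.

(** * Strict application of finite functions *)

Lemma eq_app k (f : afun A k) xs ys : xs =1 ys -> app f xs = app f ys.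
Proof. by move=> Exy; rewrite /app /all_defined (eq_pmap Exy). Qed.

Lemma app_some k (f : afun A k) (ys : k.-tuple A) :
  app f (fun i => Some (tnth ys i)) = f.[? ys].
Proof.
by rewrite /app (_ : all_defined _ = Some ys) //; apply/all_definedP.
Qed.

Lemma definedP k (xs : 'I_k -> option A) :
  (exists ys : k.-tuple A, xs =1 fun i => Some (tnth ys i)) \/
  (exists i, xs i = None).
Proof.
have [/existsP[i /eqP]|] := boolP [exists i, xs i == None].
  by right; exists i.
rewrite negb_exists => /forallP dxs; left.
have /fin_all_exists[y Ey] i : exists a, xs i = Some a.
  by move: (dxs i); case: (xs i) => // a _; exists a.
by exists [tuple y i | i < k] => i; rewrite Ey tnth_mktuple.
Qed.

Lemma all_defined_none k (xs : 'I_k -> option A) i :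
  xs i = None -> all_defined xs = None.
Proof.
move=> xsi; case Exs: all_defined => [ys|//].
by move/all_definedP: Exs => /(_ i); rewrite xsi.
Qed.

Lemma app_none k (f : afun A k) xs i : xs i = None -> app f xs = None.
Proof. by move=> xsi; rewrite /app (all_defined_none xsi). Qed.

Lemma eq_afun k (f g : afun A k) : app f =1 app g -> f = g.
Proof. by move=> Efg; apply/fmapP=> ys; rewrite -!app_some Efg. Qed.

Lemma eq_structure V (S S' : structure A V) :
  (forall f xs, app (S f) xs = app (S' f) xs) -> S = S'.
Proof.
by move=> ESS'; apply: functional_extensionality_dep => f; apply: eq_afun => xs.
Qed.

Definition vsum (V W : vocabulary) : vocabulary :=
  @Vocabulary (V + W)%type
    (fun x => match x with inl f => arity f | inr g => arity g end).

Definition ssum V W (S : structure A V) (T : structure A W) :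
  structure A (vsum V W) :=
  fun x => match x return afun A (@arity (vsum V W) x) with
           | inl f => S f
           | inr g => T g
           end.

Definition lstr V W (Z : structure A (vsum V W)) : structure A V :=
  fun f => Z (inl f).

Definition rstr V W (Z : structure A (vsum V W)) : structure A W :=
  fun g => Z (inr g).

(* Each symbol of [V] is read off as a symbol of [V'], some of whose arguments
   are filled with fixed terms. This covers both renamings and the passage to
   the state at a given moment of a time-indexed family of structures. *)
Definition simple V' V (m : structure A V' -> structure A V) : Prop :=
  forall f : V, exists (g : V') (h : 'I_(arity g) -> 'I_(arity f) + term V'),
    forall S xs, app (m S f) xs =
      app (S g) (fun i => match h i with inl j => xs j | inr t => eval S t end).

Definition tdef V (u : structure A V -> option A) : Prop :=
  exists t, forall S, eval S t = u S.

(** A property of predicates on structures, so that formulas can be assembled by closure lemmas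
    instead of being written out in well-scoped syntax. *)
Definition definable V (R : structure A V -> Prop) : Prop :=
  exists2 p : form V, first_order p & forall S, sat S p <-> R S.

Lemma simple_id V : simple (@id (structure A V)).
Proof. by move=> f; exists f, inl. Qed.

Lemma simple_sum V U W (m1 : structure A U -> structure A V)
    (m2 : structure A U -> structure A W) :
  simple m1 -> simple m2 -> simple (fun S => ssum (m1 S) (m2 S)).
Proof. by move=> s1 s2 [f|f]; [apply: s1 | apply: s2]. Qed.

Lemma simple_lstr V U W (m : structure A U -> structure A (vsum V W)) :
  simple m -> simple (fun S => lstr (m S)).
Proof. by move=> sm f; apply: (sm (inl f)). Qed.

Lemma simple_rstr V U W (m : structure A U -> structure A (vsum V W)) :
  simple m -> simple (fun S => rstr (m S)).
Proof. by move=> sm f; apply: (sm (inr f)). Qed.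

Lemma tdef_none V : tdef (fun _ : structure A V => None).
Proof. by exists (Omega V). Qed.

Lemma tdef_simple_app V U (m : structure A U -> structure A V) (f : V)
    (u : 'I_(arity f) -> structure A U -> option A) :
  simple m -> (forall i, tdef (u i)) ->
  tdef (fun S => app (m S f) (fun i => u i S)).
Proof.
move=> /(_ f)[g [h Eh]] /fin_all_exists[t Et].
exists (App (fun i => match h i with inl j => t j | inr t => t end)) => S /=.
by rewrite Eh; apply: eq_app => i; case: (h i).
Qed.

Lemma tdef_eval V U (m : structure A U -> structure A V) t :
  simple m -> tdef (fun S => eval (m S) t).
Proof.
move=> sm; elim: t => [|f ts IH] /=; first exact: tdef_none.
exact: tdef_simple_app.
Qed.

Lemma tdef_simple V U (u : structure A V -> option A)
    (m : structure A U -> structure A V) :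
  simple m -> tdef u -> tdef (fun S => u (m S)).
Proof.
move=> sm [t Et]; have [t' Et'] := tdef_eval t sm.
by exists t' => S; rewrite Et' Et.
Qed.

Lemma simple_comp V U W (m : structure A U -> structure A V)
    (m' : structure A W -> structure A U) :
  simple m -> simple m' -> simple (fun S => m (m' S)).
Proof.
move=> sm sm' f; have [g [h Eh]] := sm f; have [g' [h' Eh']] := sm' g.
(* A term that [m] puts in an argument place is over [U]; evaluating it along [m'] gives a term over
   [W]. *)
have /fin_all_exists[h2 Eh2] (j : 'I_(arity g)) :
    exists h2 : 'I_(arity f) + term W,
    forall (Z : structure A W) (xs : 'I_(arity f) -> option A),
    match h2 with inl j => xs j | inr t => eval Z t end =
    match h j with inl j => xs j | inr t => eval (m' Z) t end.
  case: (h j) => [i|t]; first by exists (inl i).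
  by have [t' Et'] := tdef_eval t sm'; exists (inr t').
exists g', (fun i => match h' i with inl j => h2 j | inr t => inr t end).
move=> Z xs.
by rewrite Eh Eh'; apply: eq_app => i; case: (h' i).
Qed.

Definition unext V k (Z : structure A (vext V k)) : structure A V :=
  fun f => Z (Some f).

(** This lets a simple map pass under a quantifier: the bound variable [None] is read as itself, and
    the fixed terms are weakened along [unext]. *)
Lemma simple_ext V U k (m : structure A U -> structure A V) :
  simple m ->
  simple (fun Z : structure A (vext U k) => sext (m (unext Z)) (Z None)).
Proof.
move=> sm [f|]; last by exists None, inl.
have [g [h Eh]] := sm f.
have simple_ext0 : simple (@unext U k) by move=> f0; exists (Some f0), inl.
have /fin_all_exists[h' Eh'] (i : 'I_(arity g)) :
    exists h' : 'I_(arity f) + term (vext U k),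
    forall (Z : structure A (vext U k)) (xs : 'I_(arity f) -> option A),
    match h' with inl j => xs j | inr t => eval Z t end =
    match h i with inl j => xs j | inr t => eval (unext Z) t end.
  case: (h i) => [j|t]; first by exists (inl j).
  by have [t' Et'] := tdef_eval t simple_ext0; exists (inr t').
by exists (Some g), h' => Z xs; rewrite Eh; apply: eq_app => i.
Qed.

(** Substitution, by induction on [p]. The vocabulary [U] and the map [m] stay general because each
    quantifier extends both. Quantifiers keep their arities, hence first-order formulas stay
    first-order. *)
Lemma sat_simple V (p : form V) : forall U (m : structure A U -> structure A V),
  simple m -> exists2 p' : form U, (first_order p -> first_order p') &
    forall S, sat S p' <-> sat (m S) p.
Proof.
elim: p => {V} [V t q|V p IHp|V p IHp q IHq|V p IHp q IHq|V p IHp q IHq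
  |V k p IHp|V k p IHp] U m sm.
- have [[t' Et] [q' Eq]] := (tdef_eval t sm, tdef_eval q sm).
  by exists (Eqn t' q') => // S /=; rewrite Et Eq.
- have [p' fp Ep] := IHp _ _ sm; exists (Neg p') => // S /=.
  by split=> np /Ep.
- have [[p' fp Ep] [q' fq Eq]] := (IHp _ _ sm, IHq _ _ sm).
  exists (And p' q') => [/= /andP[/fp-> /fq->]//|S /=].
  by rewrite Ep Eq.
- have [[p' fp Ep] [q' fq Eq]] := (IHp _ _ sm, IHq _ _ sm).
  exists (Or p' q') => [/= /andP[/fp-> /fq->]//|S /=].
  by rewrite Ep Eq.
- have [[p' fp Ep] [q' fq Eq]] := (IHp _ _ sm, IHq _ _ sm).
  exists (Imp p' q') => [/= /andP[/fp-> /fq->]//|S /=].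
  by rewrite Ep Eq.
- have [p' fp Ep] := IHp _ _ (simple_ext (k := k) sm).
  exists (All p') => [/= /andP[-> /fp]//|S /=].
  by split=> H h; apply/(Ep (sext S h)); apply: H.
- have [p' fp Ep] := IHp _ _ (simple_ext (k := k) sm).
  exists (Ex p') => [/= /andP[-> /fp]//|S /=].
  by split=> -[h H]; exists h; apply/(Ep (sext S h)).
Qed.

Lemma definable_simple V U (R : structure A V -> Prop)
    (m : structure A U -> structure A V) :
  simple m -> definable R -> definable (fun S => R (m S)).
Proof.
move=> sm [p fp Ep]; have [p' fp' Ep'] := sat_simple p sm.
by exists p' => [|S]; [apply: fp' | rewrite Ep' Ep].
Qed.

Lemma quantifier_free_first_order V (p : form V) :
  quantifier_free p -> first_order p.
Proof.
by elim: p => //= {}V p IHp q IHq /andP[/IHp-> /IHq->].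
Qed.

Lemma definable_guard V U (G : guard V) (m : structure A U -> structure A V) :
  simple m -> definable (fun S => sat (m S) (val G)).
Proof.
move=> sm; apply: (definable_simple (R := fun S => sat S (val G)) sm).
by exists (val G) => //; apply: quantifier_free_first_order; apply: valP.
Qed.

(** * Closure properties of first-order definability *)

Lemma definable_eq V (u v : structure A V -> option A) :
  tdef u -> tdef v -> definable (fun S => u S = v S).
Proof. by move=> [t Et] [q Eq]; exists (Eqn t q) => // S /=; rewrite Et Eq. Qed.

Lemma definable_not V (R : structure A V -> Prop) :
  definable R -> definable (fun S => ~ R S).
Proof. by move=> [p fp Ep]; exists (Neg p) => // S /=; rewrite Ep. Qed.

Lemma definable_and V (R Q : structure A V -> Prop) :
  definable R -> definable Q -> definable (fun S => R S /\ Q S).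
Proof.
move=> [p fp Ep] [q fq Eq]; exists (And p q) => [|S] /=; first exact/andP.
by rewrite Ep Eq.
Qed.

Lemma definable_or V (R Q : structure A V -> Prop) :
  definable R -> definable Q -> definable (fun S => R S \/ Q S).
Proof.
move=> [p fp Ep] [q fq Eq]; exists (Or p q) => [|S] /=; first exact/andP.
by rewrite Ep Eq.
Qed.

Lemma definable_imp V (R Q : structure A V -> Prop) :
  definable R -> definable Q -> definable (fun S => R S -> Q S).
Proof.
move=> [p fp Ep] [q fq Eq]; exists (Imp p q) => [|S] /=; first exact/andP.
by rewrite Ep Eq.
Qed.

(** Classically a fixed proposition is true or false, so a trivial formula expresses it. This covers
    side conditions on identifiers such as [f' <> f]. *)
Lemma definable_const V (P : Prop) : definable (fun _ : structure A V => P).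
Proof.
have defT : definable (fun _ : structure A V => True).
  by exists (Eqn (Omega V) (Omega V)).
case: (classic P) => HP.
  by have [p fp Ep] := defT; exists p => // S; rewrite Ep.
by have [p fp Ep] := definable_not defT; exists p => // S; rewrite Ep; tauto.
Qed.

(** A finite conjunction over [enum I]. It serves for identifiers and argument positions, over which
    formulas cannot quantify. *)
Lemma definable_forall_fin (I : finType) V (R : I -> structure A V -> Prop) :
  (forall i, definable (R i)) -> definable (fun S => forall i, R i S).
Proof.
move=> dR.
have [p fp Ep] : definable (fun S => forall i, i \in enum I -> R i S).
  elim: (enum I) => [|i s [p fp Ep]].
    by have [p fp Ep] := definable_const V True; exists p => // S; rewrite Ep.
  have [q fq Eq] := dR i; exists (And q p) => [|S] /=; first exact/andP.
  rewrite Ep Eq; split=> [[Ri Rs] j|Rs].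
    by rewrite inE => /orP[/eqP->//|/Rs].
  by split=> [|j js]; apply: Rs; rewrite inE ?eqxx ?js ?orbT.
exists p => // S; rewrite Ep; split=> Rs i; last by move=> _.
by apply: Rs; rewrite mem_enum.
Qed.

(** * Quantification over structures and over vectors of values *)

(** Induction on the number of symbols of [W], each of which becomes one existential quantifier in
    front of the first-order matrix. If all arities are 0, these quantifiers are atomic and the
    whole formula is first-order. *)
Lemma exists_structure_existential V W (R : structure A (vsum V W) -> Prop) :
  definable R -> exists p : form V,
    [/\ existential p, (forall w : W, arity w = 0) -> first_order p &
        forall S, sat S p <-> exists T, R (ssum S T)].
Proof.
move cW: #|W| => n; elim: n V W R cW => [|n IHn] V W R cW dR.
  have noW (w : W) : False by have := fintype0 w; rewrite cW; apply.
  pose T0 : structure A W := fun w => [fmap].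
  have sm : simple (fun S : structure A V => ssum S T0).
    by move=> [f|w]; [exists f, inl | case: (noW w)].
  have [p fp Ep] := definable_simple sm dR.
  exists p; split=> // [|S]; first exact: Ex_fo.
  rewrite Ep; split=> [RS|[T]]; first by exists T0.
  rewrite (_ : T = T0) //; apply: functional_extensionality_dep => w.
  by case: (noW w).
have /card_gt0P[w0 _] : 0 < #|W| by rewrite cW.
pose k := arity w0.
pose W' := @Vocabulary {w : W | w != w0} (fun w => arity (val w)).
(* The default [[fmap]] arises only at [w0], where [dfwith] overwrites it by [h]. *)
pose join (T : structure A W') (h : afun A k) : structure A W :=
  dfwith (fun w => match (w != w0) =P true return afun A (arity w) with
    | ReflectT w'0 => T (exist _ w w'0) | ReflectF _ => [fmap] end) h.
have join_in T h : join T h w0 = h by rewrite /join dfwith_in.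
have join_out T h (w : W') : join T h (val w) = T w.
  case: w => w ww0; rewrite /join dfwith_out 1?eq_sym //=.
  by case: eqP => // p; rewrite (bool_irrelevance ww0 p).
(* The symbol [w0] becomes the bound variable [None] of [vext V k], which leaves the smaller [W'] to
   the induction hypothesis. *)
pose m (Z : structure A (vsum (vext V k) W')) : structure A (vsum V W) :=
  ssum (unext (lstr Z)) (join (rstr Z) (lstr Z None)).
have sm : simple m.
  move=> [f|w]; first by exists (inl (Some f)), inl.
  have [->|ww0] := eqVneq w w0.
    by exists (inl None), inl => Z xs; rewrite /m /= join_in.
  exists (inr (exist _ w ww0)), inl => Z xs.
  by rewrite /m /= (join_out _ _ (exist _ w ww0)).
have cW' : #|W'| = n.
  by rewrite card_sig (eq_card (B := predC1 w0)) // cardC1 cW.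
have [p [exp fop Ep]] := IHn _ _ _ cW' (definable_simple sm dR).
exists (Ex p); split=> [|W0|S /=]; first exact: Ex_ex.
  by apply/andP; split; [apply/eqP/W0 | apply: fop => w; apply: W0].
have Em h T : m (ssum (sext S h) T) = ssum S (join T h).
  by apply: functional_extensionality_dep; case.
split=> [[h /Ep[T]]|[T RT]]; first by rewrite Em; exists (join T h).
exists (T w0); apply/Ep; exists (fun w => T (val w)); rewrite Em.
rewrite (_ : join _ _ = T) //; apply: functional_extensionality_dep => w.
have [->|ww0] := eqVneq w w0; first exact: join_in.
exact: (join_out _ _ (exist _ w ww0)).
Qed.

(** A structure over [consts k] amounts to a vector of [k] possibly undefined atoms, so atomic
    quantifiers become quantifiers over structures. *)
Definition consts k : vocabulary := @Vocabulary 'I_k (fun _ => 0).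

Definition vals k (T : structure A (consts k)) (i : 'I_k) : option A :=
  app (T i) (fun _ => None).

Lemma app0 (f : afun A 0) xs : app f xs = f.[? [tuple]].
Proof. by rewrite -app_some; apply: eq_app; case. Qed.

Lemma vals_surj k (xs : 'I_k -> option A) : exists T, vals T = xs.
Proof.
exists (fun i => if xs i is Some a then [fmap].[[tuple] <- a] else [fmap]).
apply: functional_extensionality => i.
rewrite /vals app0; case: (xs i) => [a|]; last exact: fnd_fmap0.
by rewrite fnd_set eqxx.
Qed.

Lemma tdef_val U k (m : structure A U -> structure A (consts k)) i :
  simple m -> tdef (fun S => vals (m S) i).
Proof.
move=> sm.
apply: (tdef_simple_app (m := m) (f := i) (u := fun _ _ => None)) => // _.
exact: tdef_none.
Qed.

(** The negation of an existential quantifier over structures on [consts k], whose arities are all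
    0; hence the result is first-order. *)
Lemma definable_forall k V (R : structure A V -> ('I_k -> option A) -> Prop) :
  definable (fun Z : structure A (vsum V (consts k)) =>
               R (lstr Z) (vals (rstr Z))) ->
  definable (fun S => forall xs, R S xs).
Proof.
move=> /definable_not dR.
have [p [_ /(_ (fun=> erefl)) fop Ep]] := exists_structure_existential dR.
exists (Neg p) => // S /=; rewrite Ep; split=> [nex xs|RS [T]]; last by apply.
have [T <-] := vals_surj xs.
by apply: NNPP => nR; apply: nex; exists T.
Qed.

End Definability.

Ltac solve_simple :=
  repeat first [ assumption | exact: simple_id
               | exact: simple_lstr (@simple_id _ _)
               | exact: simple_rstr (@simple_id _ _) | apply: simple_sum
               | apply: simple_lstr | apply: simple_rstr ].

(** * Revisions, composition and branching *)

Section Programs.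

Variable A : choiceType.

Lemma definable_forall1 V (R : structure A V -> option A -> Prop) :
  definable (fun Z : structure A (vsum V (consts 1)) =>
               R (lstr Z) (vals (rstr Z) ord0)) ->
  definable (fun S => forall a, R S a).
Proof.
move=> dR; have [] := definable_forall (R := fun S xs => R S (xs ord0)) dR.
move=> p fp Ep; exists p => // S; rewrite Ep.
by split=> [RS a|RS xs]; [apply: (RS (fun=> a)) | apply: RS].
Qed.

Lemma tdef_app_vals V U (m : structure A U -> structure A V) f :
  simple m -> tdef (fun Z : structure A (vsum U (consts (arity f))) =>
    app (m (lstr Z) f) (vals (rstr Z))).
Proof.
move=> sm; apply: (tdef_simple_app (m := fun Z => m (lstr Z))
                                   (u := fun i Z => vals (rstr Z) i)).
  by apply: (simple_comp sm); solve_simple.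
by move=> i; apply: tdef_val; solve_simple.
Qed.

Lemma definable_eq_afun V U (m1 m2 : structure A U -> structure A V) f :
  simple m1 -> simple m2 -> definable (fun S => m1 S f = m2 S f).
Proof.
move=> s1 s2.
have [] : definable (fun S => forall xs, app (m1 S f) xs = app (m2 S f) xs).
  by apply: definable_forall; apply: definable_eq; apply: tdef_app_vals.
move=> p fp Ep; exists p => // S; rewrite Ep.
by split=> [/eq_afun|->].
Qed.

Lemma definable_eq_structure V U (m1 m2 : structure A U -> structure A V) :
  simple m1 -> simple m2 -> definable (fun S => m1 S = m2 S).
Proof.
move=> s1 s2; have [p fp Ep] :=
  definable_forall_fin (fun f => definable_eq_afun f s1 s2).
exists p => // S; rewrite Ep; split=> [E|-> //].
by apply: functional_extensionality_dep.
Qed.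

(** * Pointwise updates *)

(** An account of [set_at] in first-order terms. The clause [xs i <> None] reflects strictness: at
    an undefined argument nothing changes. *)
Definition updates V (S S' : structure A V) f (xs : 'I_(arity f) -> option A)
    v : Prop :=
  (forall f', f' <> f -> S' f' = S f') /\
  forall ys, ((forall i, ys i = xs i /\ xs i <> None) -> app (S' f) ys = v) /\
    (~ (forall i, ys i = xs i /\ xs i <> None) ->
     app (S' f) ys = app (S f) ys).

(** The structure [set_at S xs v] satisfies the pointwise conditions, and these determine every
    value of [S'], hence [S'] itself by extensionality. *)
Lemma set_atP V (S S' : structure A V) f (xs : 'I_(arity f) -> option A) v :
  S' = set_at S xs v <-> updates S S' xs v.
Proof.
have upd : updates S (set_at S xs v) xs v.
  rewrite /set_at; case: (definedP xs) => [[zs Exs]|[i xsi]]; last first.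
    rewrite (all_defined_none xsi); split=> // ys; split=> [|//].
    by move=> /(_ i)[_ /(_ xsi)].
  rewrite ((all_definedP xs zs).2 Exs); split=> [f' nf'f|ys].
    by rewrite dfwith_out // eq_sym; apply/eqP.
  rewrite dfwith_in; split=> [Eys|nEys].
    rewrite (@eq_app _ _ _ ys (fun i => Some (tnth zs i))) => [|i]; last first.
      by rewrite (Eys i).1.
    by rewrite app_some; case: v => [a|]; rewrite ?fnd_set ?fnd_rem1 eqxx.
  case: (definedP ys) => [[ws Eys]|[i ysi]]; last by rewrite !(app_none _ ysi).
  rewrite !(eq_app _ Eys) !app_some.
  have wz : ws != zs.
    apply/eqP=> wz; apply: nEys => i; split; last by rewrite Exs.
    by rewrite Eys Exs wz.
  by case: v => [a|]; rewrite ?fnd_set ?fnd_rem1 (negPf wz).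
split=> [-> //|[out1 in1]]; case: upd => [out2 in2].
apply: eq_structure => f' ys; case: (classic (f' = f)) => [Ef|nf].
  move: ys; rewrite Ef => ys; have [[i1 n1] [i2 n2]] := (in1 ys, in2 ys).
  have [h|h] := classic (forall i, ys i = xs i /\ xs i <> None).
    by rewrite (i1 h) (i2 h).
  by rewrite (n1 h) (n2 h).
by rewrite out1 // out2.
Qed.

Lemma definable_updates V U (m1 m2 : structure A U -> structure A V) f
    (xs : 'I_(arity f) -> structure A U -> option A) v :
  simple m1 -> simple m2 -> (forall i, tdef (xs i)) -> tdef v ->
  definable (fun S => updates (m1 S) (m2 S) (fun i => xs i S) (v S)).
Proof.
move=> s1 s2 dxs dv; apply: definable_and.
  apply: definable_forall_fin => f'; apply: definable_imp.
    exact: definable_const.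
  exact: definable_eq_afun.
have sl : simple (@lstr A U (consts (arity f))) by solve_simple.
have cond : definable (fun Z : structure A (vsum U (consts (arity f))) =>
    forall i, vals (rstr Z) i = xs i (lstr Z) /\ xs i (lstr Z) <> None).
  apply: definable_forall_fin => i.
  have dx := tdef_simple sl (dxs i).
  apply: definable_and; first apply: definable_eq => //.
    by apply: tdef_val; solve_simple.
  by apply: definable_not; apply: definable_eq => //; apply: tdef_none.
apply: definable_forall; apply: definable_and; apply: definable_imp => //.
- by apply: definable_eq; [apply: tdef_app_vals | apply: tdef_simple sl dv].
- exact: definable_not.
- by apply: definable_eq; apply: tdef_app_vals.
Qed.

(** * Existential relations and the programs without iteration *)

(** A normal form: all function quantifiers are bundled into one witness [T] in front of a
    first-order matrix, so that program constructs only have to merge witnesses or index them by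
    time. *)
Definition existential_rel V (R : structure A V -> structure A V -> Prop) :
    Prop :=
  exists W (Q : structure A (vsum (vsum V V) W) -> Prop),
    definable Q /\ forall S S', R S S' <-> exists T, Q (ssum (ssum S S') T).

Lemma definable_existential_rel V (R : structure A V -> structure A V -> Prop) :
  definable (fun Z : structure A (vsum V V) => R (lstr Z) (rstr Z)) ->
  existential_rel R.
Proof.
(* The vocabulary is empty, so the witness carries no information. *)
move=> dR; exists (consts 0), (fun Z => R (lstr (lstr Z)) (rstr (lstr Z))).
split=> [|S S'].
  apply: (definable_simple (R := fun Z => R (lstr Z) (rstr Z)) _ dR).
  by solve_simple.
by split=> [RS|[]//]; exists (fun=> [fmap]).
Qed.

Lemma extension_existential (V : vocabulary) (f : V) ts q :
  existential_rel (revises (A := A) (Extension (f := f) ts q)).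
Proof.
have sl : simple (@lstr A V V) by solve_simple.
have sr : simple (@rstr A V V) by solve_simple.
have dt t := tdef_eval t sl.
have dc : definable (fun Z : structure A (vsum V V) =>
    eval (lstr Z) (App ts) = None).
  by apply: definable_eq (dt _) (tdef_none _ _).
apply: definable_existential_rel.
have [] : definable (fun Z : structure A (vsum V V) =>
   (eval (lstr Z) (App ts) = None -> updates (lstr Z) (rstr Z)
       (fun i => eval (lstr Z) (ts i)) (eval (lstr Z) q)) /\
   (~ eval (lstr Z) (App ts) = None -> rstr Z = lstr Z)).
  apply: definable_and; apply: definable_imp => //.
  - by apply: definable_updates.
  - by apply: definable_not.
  - exact: definable_eq_structure.
move=> p fp Ep; exists p => // Z; rewrite Ep /revises -set_atP.
case: (eval _ _) => [a|]; last by split=> [[-> //]|].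
by split=> [[_ ->]|].
Qed.

Lemma contraction_existential (V : vocabulary) (f : V) ts :
  existential_rel (revises (A := A) (Contraction (f := f) ts)).
Proof.
have sl : simple (@lstr A V V) by solve_simple.
have sr : simple (@rstr A V V) by solve_simple.
apply: definable_existential_rel.
have [] := definable_updates sl sr (fun i => tdef_eval (ts i) sl)
  (tdef_none A _).
by move=> p fp Ep; exists p => // Z; rewrite Ep -set_atP.
Qed.

Lemma deletion_existential V (c : token V) :
  existential_rel (revises (A := A) (Deletion c)).
Proof.
have sl : simple (@lstr A V V) by solve_simple.
have sr : simple (@rstr A V V) by solve_simple.
apply: definable_existential_rel.
have [] : definable (fun Z : structure A (vsum V V) => forall f xs,
    (app (lstr Z f) xs = eval (lstr Z) (tok c) -> app (rstr Z f) xs = None) /\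
    (~ app (lstr Z f) xs = eval (lstr Z) (tok c) ->
     app (rstr Z f) xs = app (lstr Z f) xs)).
  apply: definable_forall_fin => f; apply: definable_forall.
  pose U := vsum (vsum V V) (consts (arity f)).
  have dl := tdef_app_vals f sl; have dr := tdef_app_vals f sr.
  have dc : definable (fun Z : structure A U =>
      app (lstr (lstr Z) f) (vals (rstr Z)) = eval (lstr (lstr Z)) (tok c)).
    by apply: definable_eq dl _; apply: tdef_eval; solve_simple.
  apply: definable_and; apply: definable_imp => //.
  - by apply: definable_eq dr (tdef_none _ _).
  - exact: definable_not.
  - exact: definable_eq.
move=> p fp Ep; exists p => // Z; rewrite Ep /revises; split=> H f xs.
  have [H1 H2] := H f (fun i => Some (tnth xs i)).
  by move: H1 H2; rewrite !app_some; case: eqP => [E ->|E _ ->].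
case: (definedP xs) => [[ys Exs]|[i xsi]]; last by rewrite !(app_none _ xsi).
by rewrite !(eq_app _ Exs) !app_some H; case: eqP.
Qed.

(** Being outside the scope, phrased through [app] so that it is first-order; argument vectors with
    an undefined component give no value and impose nothing. *)
Definition fresh V (S : structure A V) (a : option A) :=
  forall f xs, ~ app (S f) xs = None ->
    ~ app (S f) xs = a /\ forall i, ~ xs i = a.

Lemma freshP V (S : structure A V) a : fresh S (Some a) <-> ~ in_scope S a.
Proof.
split=> [fr [f [xs [b [Eb ab]]]]|nsc f xs].
  have [] := fr f (fun i => Some (tnth xs i)); first by rewrite app_some Eb.
  rewrite app_some Eb => nb nx; case: ab => [/tnthP[i Ei]|Eab].
    by apply: (nx i); rewrite Ei.
  by apply: nb; rewrite Eab.
case: (definedP xs) => [[ys Exs]|[i xsi]]; last by rewrite !(app_none _ xsi).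
rewrite !(eq_app _ Exs) !app_some; case Eb: (_.[? _]) => [b|//] _; split.
  by case=> Eba; apply: nsc; exists f, ys, b; split=> //; right.
move=> i; rewrite Exs => -[Ea]; apply: nsc; exists f, ys, b; split=> //.
by left; rewrite -Ea mem_tnth.
Qed.

Lemma definable_fresh V U (m : structure A U -> structure A V) u :
  simple m -> tdef u -> definable (fun S => fresh (m S) (u S)).
Proof.
move=> sm du; apply: definable_forall_fin => f; apply: definable_forall.
have sl : simple (@lstr A U (consts (arity f))) by solve_simple.
have du' := tdef_simple sl du.
have dapp := tdef_app_vals f sm.
apply: definable_imp.
  by apply: definable_not; apply: definable_eq dapp (tdef_none _ _).
apply: definable_and; first by apply: definable_not; apply: definable_eq.
apply: definable_forall_fin => i; apply: definable_not.
apply: definable_eq => //.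
by apply: tdef_val; solve_simple.
Qed.

Lemma inception_existential V (c : token V) :
  existential_rel (revises (A := A) (Inception c)).
Proof.
pose U := vsum (vsum V V) (consts 1).
pose mS (Z : structure A U) : structure A V := lstr (lstr Z).
pose mS' (Z : structure A U) : structure A V := rstr (lstr Z).
pose a (Z : structure A U) := vals (rstr Z) ord0.
have sS : simple mS by rewrite /mS; solve_simple.
have sS' : simple mS' by rewrite /mS'; solve_simple.
have da : tdef a by apply: tdef_val; solve_simple.
have dc : definable (fun Z => eval (mS Z) (tok c) = None).
  by apply: definable_eq (tdef_none _ _); apply: tdef_eval.
(* The single constant is the new atom. It may also be undefined as far as its quantifier goes, so
   its definedness is demanded separately. *)
exists (consts 1), (fun Z =>
  (eval (mS Z) (tok c) = None -> ~ a Z = None /\ fresh (mS Z) (a Z) /\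
     updates (mS Z) (mS' Z) (fun _ : 'I_(arity (val c)) => None) (a Z)) /\
  (~ eval (mS Z) (tok c) = None -> mS' Z = mS Z)).
split=> [|S S'].
  apply: definable_and; apply: definable_imp => //.
  - apply: definable_and.
      by apply: definable_not; apply: definable_eq da (tdef_none _ _).
    apply: definable_and; first exact: definable_fresh.
    by apply: definable_updates => // i; apply: tdef_none.
  - exact: definable_not.
  - exact: definable_eq_structure.
rewrite /revises /mS /mS' /a; case: (eval _ _) => [b|].
  split=> [->|[T [_ E]]]; last by apply: E.
  by exists (fun=> [fmap]).
split=> [[b nb ES']|[T [/(_ erefl)[]]]].
  have [T ET] := vals_surj (fun _ : 'I_1 => Some b).
  exists T; split=> // _; rewrite /rstr /= -/(vals T ord0) ET; split=> //.
  by split; [apply/freshP | apply/set_atP].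
case Ea: (vals _ _) => [b|//] _ [fr upd] _.
by exists b; [apply/freshP | apply/set_atP].
Qed.

Lemma revision_existential V (r : revision V) :
  existential_rel (revises (A := A) r).
Proof.
case: r => [f ts q|c|f ts|c].
- exact: extension_existential.
- exact: inception_existential.
- exact: contraction_existential.
- exact: deletion_existential.
Qed.

Lemma comp_existential V (R1 R2 : structure A V -> structure A V -> Prop) :
  existential_rel R1 -> existential_rel R2 ->
  existential_rel (fun S S' => exists2 S1, R1 S S1 & R2 S1 S').
Proof.
move=> [W1 [Q1 [d1 E1]]] [W2 [Q2 [d2 E2]]].
(* The witness consists of the intermediate structure and the witnesses of both relations. *)
exists (vsum V (vsum W1 W2)), (fun Z =>
  Q1 (ssum (ssum (lstr (lstr Z)) (lstr (rstr Z))) (lstr (rstr (rstr Z)))) /\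
  Q2 (ssum (ssum (lstr (rstr Z)) (rstr (lstr Z))) (rstr (rstr (rstr Z))))).
split=> [|S S'].
  by apply: definable_and;
    [apply: definable_simple d1 | apply: definable_simple d2]; solve_simple.
split=> [[S1 /E1[T1 q1] /E2[T2 q2]]|[T [q1 q2]]].
  by exists (ssum S1 (ssum T1 T2)).
exists (lstr T); first by apply/E1; exists (lstr (rstr T)).
by apply/E2; exists (rstr (rstr T)).
Qed.

Lemma branch_existential V (G : guard V)
    (R1 R2 : structure A V -> structure A V -> Prop) :
  existential_rel R1 -> existential_rel R2 ->
  existential_rel (fun S S' =>
    (sat S (val G) /\ R1 S S') \/ (~ sat S (val G) /\ R2 S S')).
Proof.
move=> [W1 [Q1 [d1 E1]]] [W2 [Q2 [d2 E2]]].
exists (vsum W1 W2), (fun Z =>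
  (sat (lstr (lstr Z)) (val G) /\ Q1 (ssum (lstr Z) (lstr (rstr Z)))) \/
  (~ sat (lstr (lstr Z)) (val G) /\ Q2 (ssum (lstr Z) (rstr (rstr Z))))).
split=> [|S S'].
  have dG : definable (fun Z : structure A (vsum (vsum V V) (vsum W1 W2)) =>
      sat (lstr (lstr Z)) (val G)) by apply: definable_guard; solve_simple.
  apply: definable_or; apply: definable_and => //.
  - by apply: definable_simple d1; solve_simple.
  - exact: definable_not.
  - by apply: definable_simple d2; solve_simple.
rewrite E1 E2; split=> [[[g [T q]]|[g [T q]]]|[T [[g q]|[g q]]]].
(* The branch not taken gets empty functions as its witness. *)
- by exists (ssum T (fun=> [fmap])); left.
- by exists (ssum (fun=> [fmap]) T); right.
- by left; split=> //; exists (lstr T).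
- by right; split=> //; exists (rstr T).
Qed.

End Programs.

(** * Iteration *)

Section Iteration.

Variable A : choiceType.

(** * Time-indexed families of structures *)

Definition tabulate k (ks : seq (k.-tuple A)) (u : k.-tuple A -> option A) :
  afun A k :=
  foldr (fun ys f => if u ys is Some a then f.[ys <- a] else f) [fmap] ks.

Lemma fnd_tabulate k ks (u : k.-tuple A -> option A) ys :
  (u ys -> ys \in ks) -> (tabulate ks u).[? ys] = u ys.
Proof.
move=> uks; have -> : (tabulate ks u).[? ys] = if ys \in ks then u ys else None.
  elim: ks {uks} => [|zs ks IH] /=; first exact: fnd_fmap0.
  rewrite inE; have [<-|nyz] := eqVneq ys zs; case Eu: (u _) => [a|] /=.
  - by rewrite fnd_set eqxx.
  - by rewrite IH; case: ifP.
  - by rewrite fnd_set (negPf nyz).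
  - exact: IH.
by case Eu: (u ys) uks => [a|] => [->|_] //; case: ifP.
Qed.

(** An undefined time gives the empty function, in accordance with strictness, so that [app_slice]
    holds for every [t]. *)
Definition slice k (F : afun A k.+1) (t : option A) : afun A k :=
  if t is Some x then
    tabulate [seq behead_tuple ys | ys <- domf F]
             (fun ys => F.[? [tuple of x :: ys]])
  else [fmap].

Lemma fnd_slice k (F : afun A k.+1) x ys :
  (slice F (Some x)).[? ys] = F.[? [tuple of x :: ys]].
Proof.
rewrite fnd_tabulate // => Fxy; apply/mapP; exists [tuple of x :: ys].
  by rewrite -fndSome.
exact: val_inj.
Qed.

Lemma app_slice k (F : afun A k.+1) t xs :
  app (slice F t) xs =
  app F (fun i => if unlift ord0 i is Some j then xs j else t).
Proof.
case: t => [x|]; last first.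
  rewrite (@app_none _ _ F _ ord0) ?unlift_none //.
  by rewrite /app; case: all_defined => //= ys; apply: fnd_fmap0.
case: (definedP xs) => [[ys Exs]|[i xsi]]; last first.
  by rewrite (app_none _ xsi) (@app_none _ _ F _ (lift ord0 i)) // liftK.
rewrite (eq_app _ Exs) app_some fnd_slice -app_some; apply: eq_app => i.
by case: unliftP => [j|] ->; rewrite ?tnthS ?tnth0 // -Exs.
Qed.

(* The extra first argument of each symbol is the time. *)
Definition timed (V : vocabulary) : vocabulary :=
  @Vocabulary V (fun f => (arity f).+1).

Definition state_at V (F : structure A (timed V)) (t : option A) :
  structure A V := fun f => slice (F f) t.

Lemma simple_state_at V U (m : structure A U -> structure A (timed V)) t :
  simple m -> tdef t -> simple (fun S => state_at (m S) (t S)).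
Proof.
move=> sm [q Eq] f; have [g [h Eh]] := sm f.
exists g, (fun i => match h i with
  | inl j => if unlift ord0 j is Some j' then inl j' else inr q
  | inr t => inr t end) => S xs.
rewrite app_slice Eh; apply: eq_app => i; case: (h i) => // j.
by case: unliftP.
Qed.

(** The graph of [st i f] is stored with [e i] prefixed to every argument tuple; injectivity of [e]
    recovers [i] from the prefix. *)
Lemma state_at_surj V (e : nat -> A) n (st : nat -> structure A V) :
  injective e -> exists F, forall i, i <= n -> state_at F (Some (e i)) = st i.
Proof.
move=> injE.
pose F (f : V) := tabulate
  (flatten [seq [seq [tuple of e i :: (ys : (arity f).-tuple A)]
                | ys <- domf (st i f)] | i <- iota 0 n.+1])
  (fun zs => if [pick i : 'I_n.+1 | e i == thead zs] is Some i
             then (st i f).[? behead_tuple zs] else None).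
exists F => i le_in; apply: functional_extensionality_dep => f.
apply/fmapP=> ys; rewrite fnd_slice fnd_tabulate.
  case: pickP => [j /eqP/injE Eji|/(_ (Ordinal (le_in : i < n.+1)))/eqP[]//].
  by rewrite Eji; congr (_.[? _]); apply: val_inj.
case: pickP => // j /eqP/injE Eji dys; apply/flattenP.
exists [seq [tuple of e i :: (ys : (arity f).-tuple A)] | ys <- domf (st i f)].
  by apply/mapP; exists i => //; rewrite mem_iota.
apply/mapP; exists ys => //; move: dys; rewrite Eji -fndSome.
by have -> : behead_tuple [tuple of e i :: ys] = ys by apply: val_inj.
Qed.

(** * Chains of moments *)

Definition apply1 (f : afun A 1) (t : option A) : option A := app f (fun=> t).

Lemma apply1_none f : apply1 f None = None.
Proof. exact: (@app_none _ _ _ _ ord0). Qed.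

Lemma apply1_some f x : apply1 f (Some x) = f.[? [tuple x]].
Proof. by rewrite -app_some; apply: eq_app => i; rewrite ord1 tnth0. Qed.

(** The moments are [z] and the values of [s], which is why two clauses say that one without
    successor is [e]. Cycles apart from the orbit of [z] are not excluded. *)
Definition chain (s : option A -> option A) (z e : option A) : Prop :=
  ~ z = None /\ (forall t, ~ s t = z) /\
  (forall t t', ~ s t = None -> s t = s t' -> t = t') /\
  (s z = None -> z = e) /\
  (forall t, ~ s t = None -> s (s t) = None -> s t = e).

(* Finiteness of [f] is what bounds the length of the chain. *)
Lemma chain_terminates (f : afun A 1) z e :
  chain (apply1 f) z e -> exists n, iter n (apply1 f) z = None.
Proof.
move=> [nz [nsz [inj _]]]; apply: NNPP => nterm.
set s := apply1 f in nsz inj nterm.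
have def i : iter i s z <> None by move=> Ei; apply: nterm; exists i.
(* Injectivity cancels the common steps until [z] itself would be a value of [s]. *)
have noloop i d : iter i s z <> iter (d.+1 + i) s z.
  elim: i => [|i IH]; first by rewrite addn0 => /esym; apply: nsz.
  by rewrite addnS /= => /inj Ei; apply: IH; apply: Ei; apply: (def i.+1).
have injit i j : iter i s z = iter j s z -> i = j.
  wlog le_ij : i j / i <= j => [wl|] E.
    by case: (leqP i j) => [/wl|/ltnW/wl] ->.
  move: le_ij; rewrite leq_eqVlt => /orP[/eqP//|lt_ij].
  case: (@noloop i (j - i).-1); rewrite prednK ?subn_gt0 // subnK //.
  exact: ltnW.
case Ez: z nz => [x0|//] _.
pose x i := odflt x0 (iter i s z).
have Ex i : iter i s z = Some (x i).
  by rewrite /x; case E: (iter i s z) => [//|]; case: (def i).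
(* One iterate more than the domain of [f] has elements; they are distinct and all lie in that
   domain. *)
pose xs := [seq [tuple x i] | i <- iota 0 (size (domf f)).+1].
have uxs : uniq xs.
  rewrite map_inj_uniq ?iota_uniq // => i j /(congr1 val)[Exy].
  by apply: injit; rewrite !Ex Exy.
have sub : {subset xs <= domf f}.
  move=> _ /mapP[i _ ->]; rewrite -fndSome -apply1_some -Ex.
  by rewrite -/s -iterS Ex.
have := uniq_leq_size uxs sub.
by rewrite size_map size_iota ltnn.
Qed.

(** * Coded runs of an iteration *)

Definition succ_voc : vocabulary := @Vocabulary unit (fun=> 1).

Definition run V W (G : form V) (Q : structure A (vsum (vsum V V) W) -> Prop)
    (S S' : structure A V) (F : structure A (timed V))
    (H : structure A (timed W)) (s : option A -> option A) (z e : option A) :=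
  chain s z e /\ state_at F z = S /\ state_at F e = S' /\ ~ sat S' G /\
  forall t, ~ s t = None -> sat (state_at F t) G /\
    Q (ssum (ssum (state_at F t) (state_at F (s t))) (state_at H t)).

Lemma definable_run V W U (G : guard V) Q
    (S S' : structure A U -> structure A V)
    (F : structure A U -> structure A (timed V))
    (H : structure A U -> structure A (timed W))
    (s : structure A U -> structure A succ_voc) z e :
  definable Q -> simple S -> simple S' -> simple F -> simple H -> simple s ->
  tdef z -> tdef e ->
  definable (fun Z => run (val G) Q (S Z) (S' Z) (F Z) (H Z)
                          (apply1 (s Z tt)) (z Z) (e Z)).
Proof.
move=> dQ sS sS' sF sH ss dz de.
(* Stated over any [U'], since the successor is applied over [U] itself and under one or two further
   atomic quantifiers. *)
have ds U' (m : structure A U' -> structure A U)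
    (t : structure A U' -> option A) :
    simple m -> tdef t -> tdef (fun Z => apply1 (s (m Z) tt) (t Z)).
  move=> sm dt; apply: (tdef_simple_app (m := fun Z => s (m Z)) (f := tt)
                                        (u := fun _ => t)) => //.
  exact: simple_comp ss sm.
have dn U' (t : structure A U' -> option A) :
  tdef t -> definable (fun Z => t Z = None).
  by move=> dt; apply: definable_eq dt (tdef_none _ _).
have dnn U' (t : structure A U' -> option A) :
  tdef t -> definable (fun Z => ~ t Z = None).
  by move=> dt; apply: definable_not; apply: dn.
pose U1 := vsum U (consts 1).
have sl : simple (@lstr A U (consts 1)) by solve_simple.
have dt1 : tdef (fun Z : structure A U1 => vals (rstr Z) ord0).
  by apply: tdef_val; solve_simple.
have ds1 := ds _ _ _ sl dt1.
have dss1 := ds _ _ _ sl ds1.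
apply: definable_and.
  apply: definable_and; first exact: dnn.
  apply: definable_and.
    apply: definable_forall1; apply: definable_not.
    by apply: definable_eq ds1 (tdef_simple sl dz).
  apply: definable_and.
    apply: definable_forall1; apply: definable_forall1.
    pose U2 := vsum U1 (consts 1).
    have sl2 : simple (fun Z : structure A U2 => lstr (lstr Z)) by solve_simple.
    have dt : tdef (fun Z : structure A U2 => vals (rstr (lstr Z)) ord0).
      by apply: tdef_val; solve_simple.
    have dt' : tdef (fun Z : structure A U2 => vals (rstr Z) ord0).
      by apply: tdef_val; solve_simple.
    have dst := ds _ _ _ sl2 dt; have dst' := ds _ _ _ sl2 dt'.
    apply: definable_imp; first exact: dnn.
    by apply: definable_imp; apply: definable_eq.
  apply: definable_and.
    apply: definable_imp; last exact: definable_eq.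
    by apply: dn; apply: (ds _ id) => //; apply: simple_id.
  apply: definable_forall1; apply: definable_imp; first exact: dnn.
  apply: definable_imp; first exact: dn.
  exact: definable_eq ds1 (tdef_simple sl de).
apply: definable_and.
  by apply: definable_eq_structure => //; apply: simple_state_at.
apply: definable_and.
  by apply: definable_eq_structure => //; apply: simple_state_at.
apply: definable_and; first by apply: definable_not; apply: definable_guard.
apply: definable_forall1; apply: definable_imp; first exact: dnn.
have sF1 := simple_comp sF sl; have sH1 := simple_comp sH sl.
apply: definable_and; first by apply: definable_guard; apply: simple_state_at.
apply: definable_simple dQ.
apply: simple_sum; last exact: simple_state_at.
by apply: simple_sum; apply: simple_state_at.
Qed.

Lemma run_iterates V W (G : form V)
    (Q : structure A (vsum (vsum V V) W) -> Prop)
    (R : structure A V -> structure A V -> Prop) S S' F H (s : afun A 1) z e :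
  (forall S1 S2, R S1 S2 <-> exists T, Q (ssum (ssum S1 S2) T)) ->
  run G Q S S' F H (apply1 s) z e -> iterates G R S S'.
Proof.
move=> ER [ch [<- [ES' [nG step]]]]; have [n] := chain_terminates ch.
case: ch => [nz [_ [_ [zend tend]]]].
(* Induction on the number of steps until [s] is undefined. Later moments are values of [s] and so
   do not start a [chain]; only definedness and the clause on [e] are carried along. *)
elim: n z nz zend => [//|n IHn] t nt tE; rewrite iterSr => Hn.
case Est: (apply1 s t) => [x|].
  have nst : apply1 s t <> None by rewrite Est.
  have [Gt Qt] := step t nst.
  apply: (Iterates_step (S1 := state_at F (apply1 s t))) => //.
    by apply/ER; eexists; apply: Qt.
  by apply: IHn => //; apply: tend.
rewrite (tE Est) ES'; exact: Iterates_stop.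
Qed.

Lemma iterates_states V W (G : form V)
    (Q : structure A (vsum (vsum V V) W) -> Prop)
    (R : structure A V -> structure A V -> Prop) S S' :
  (forall S1 S2, R S1 S2 <-> exists T, Q (ssum (ssum S1 S2) T)) ->
  iterates G R S S' ->
  exists n (st : nat -> structure A V) (wt : nat -> structure A W),
    [/\ st 0 = S, st n = S', ~ sat S' G & forall i, i < n ->
      sat (st i) G /\ Q (ssum (ssum (st i) (st i.+1)) (wt i))].
Proof.
move=> ER.
elim=> {S S'} [S nG|S S1 S' GS /ER[T QT] _ [n [st [wt [st0 stn nG IH]]]]].
  by exists 0, (fun=> S), (fun=> fun=> [fmap]).
exists n.+1, (fun i => if i is j.+1 then st j else S),
  (fun i => if i is j.+1 then wt j else T); split=> // -[_|i /IH//].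
by rewrite st0.
Qed.

Lemma iterates_run V W (G : form V)
    (Q : structure A (vsum (vsum V V) W) -> Prop)
    (R : structure A V -> structure A V -> Prop) S S' (a : nat -> A) :
  injective a ->
  (forall S1 S2, R S1 S2 <-> exists T, Q (ssum (ssum S1 S2) T)) ->
  iterates G R S S' ->
  exists F H s z e, run G Q S S' F H (apply1 s) z e.
Proof.
move=> inja ER /(iterates_states ER)[n [st [wt [st0 stn nG step]]]].
have [F EF] := state_at_surj n st inja.
have [H EH] := state_at_surj n wt inja.
(* The domain is [a i] for [i < n], so that [a n] is the moment without successor. *)
pose s : afun A 1 := tabulate [seq [tuple a i] | i <- iota 0 n]
  (fun ys => if [pick i : 'I_n | a i == thead ys] is Some i
             then Some (a i.+1) else None).
have sE t : apply1 s t = None \/ exists2 i, i < n &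
    t = Some (a i) /\ apply1 s t = Some (a i.+1).
  case: t => [x|]; last by left; apply: apply1_none.
  rewrite apply1_some fnd_tabulate; case: pickP => [i|]; rewrite ?theadE //.
  - by move/eqP<-; right; exists i.
  - by left.
  - by move=> /eqP <- _; apply: map_f; rewrite mem_iota /=.
have sS i : i < n -> apply1 s (Some (a i)) = Some (a i.+1).
  move=> lt_in; rewrite apply1_some fnd_tabulate.
    case: pickP => [j /eqP|/(_ (Ordinal lt_in))]; rewrite theadE ?eqxx //.
    by move/inja->.
  by move=> _; apply: map_f; rewrite mem_iota.
have sn : apply1 s (Some (a n)) = None.
  case: (sE (Some (a n))) => // -[i lt_in [[/inja Eni] _]].
  by rewrite Eni ltnn in lt_in.
exists F, H, s, (Some (a 0)), (Some (a n)); split.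
  split=> //; split=> [t|].
    by case: (sE t) => [->//|[i _ [_ ->]] [/inja]].
  split=> [t t'|].
    case: (sE t) => [->//|[i _ [-> ->]] _].
    by case: (sE t') => [->//|[j _ [-> ->]] [/inja[->]]].
  split.
    (* With no steps the initial moment is also the last. *)
    by case: (posnP n) => [-> //|n0]; rewrite sS.
  move=> t; case: (sE t) => [->//|[i lt_in [_ ->]] _].
  by move: lt_in; rewrite leq_eqVlt => /orP[/eqP->//|/sS->].
split; first by rewrite EF.
split; first by rewrite EF.
split=> // t; case: (sE t) => [->//|[i lt_in [-> ->]] _].
rewrite (EF _ lt_in) (EF _ (ltnW lt_in)) (EH _ (ltnW lt_in)); exact: step.
Qed.

Lemma iterates_existential V (G : guard V)
    (R : structure A V -> structure A V -> Prop) (a : nat -> A) :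
  injective a -> existential_rel R -> existential_rel (iterates (val G) R).
Proof.
move=> inja [W [Q [dQ ER]]].
pose U := vsum (vsum V V)
  (vsum (vsum (timed V) (timed W)) (vsum succ_voc (consts 2))).
(* Timed copies for states and witnesses, one unary symbol for the successor, and two constants for
   the first and last moments. *)
exists (vsum (vsum (timed V) (timed W)) (vsum succ_voc (consts 2))),
  (fun Z : structure A U =>
     run (val G) Q (lstr (lstr Z)) (rstr (lstr Z)) (lstr (lstr (rstr Z)))
       (rstr (lstr (rstr Z))) (apply1 (lstr (rstr (rstr Z)) tt))
       (vals (rstr (rstr (rstr Z))) ord0)
       (vals (rstr (rstr (rstr Z))) ord_max)).
split=> [|S S'].
  by apply: (@definable_run V W U G Q _ _ _ _
                            (fun Z => lstr (rstr (rstr Z)))) => //;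
    try apply: tdef_val; solve_simple.
split=> [/(iterates_run inja ER)[F [H [s [z [e runS]]]]]|[T]]; last first.
  exact: run_iterates.
have [ze Eze] := vals_surj (fun i : 'I_2 => if i == ord0 then z else e).
exists (ssum (ssum F H) (ssum (fun _ : succ_voc => s) ze)).
have [Ez Ee] : vals ze ord0 = z /\ vals ze ord_max = e by rewrite Eze.
by rewrite -Ez -Ee in runS; apply: runS.
Qed.

Lemma yields_existential V (P : program V) (a : nat -> A) :
  injective a -> existential_rel (yields (A := A) P).
Proof.
move=> inja; elim: P => [r|P IHP Q IHQ|G P IHP Q IHQ|G P IHP].
- exact: revision_existential.
- exact: comp_existential.
- exact: branch_existential.
- exact: iterates_existential inja IHP.
Qed.

End Iteration.

Theorem theorem5 (A : choiceType)
  (A_denumerable : exists e : nat -> A, bijective e)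
  (V : vocabulary) (P : program V) :
  exists phi : form (vpair V),
    existential phi /\
    forall S S' : structure A V, sat (spair S S') phi <-> yields P S S'.
Proof.
have [e /bij_inj inje] := A_denumerable.
have [W [Q [dQ EP]]] := yields_existential P inje.
have [phi [ex_phi _ Ephi]] := exists_structure_existential dQ.
(* Here [vpair V] and [spair S S'] are convertible to [vsum V V] and [ssum S S']. *)
exists phi; split=> // S S'; rewrite EP; exact: Ephi.
Qed.
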